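(* Let $n\ge 1$ be an integer, $p=2^{n}-1$ and $p'=2p+1=2^{n+1}-1$. Then $$\frac{1}{2}\left\{ b^{(p')},\ \mathbf{1}^{\otimes n}\otimes b^{(1)}\right\} = b^{(p)}\otimes \mathbf{1},$$ where $b^{(p)}$ denotes Green's matrix representation of the parafermi operator of order $p$.
   Context: For a positive integer $p$, Green's matrix $b^{(p)}$ is the $(p+1)\times(p+1)$ matrix with entries $(b^{(p)})_{\alpha\beta}=B^{(p)}_{\beta}\,\delta_{\alpha,\beta+1}$ for $\alpha,\beta\in\{1,\dots,p+1\}$, where $B^{(p)}_{\beta}=\sqrt{\beta(p-\beta+1)}$ and $\delta$ is the Kronecker delta. In particular $b^{(1)}=\begin{pmatrix}0&0\\1&0\end{pmatrix}$. The symbol $\mathbf{1}$ denotes the $2\times 2$ identity matrix, $\mathbf{1}^{\otimes n}$ its $n$-fold Kronecker power (the $2^n\times 2^n$ identity matrix), $\otimes$ is the Kronecker product of matrices (with $A\otimes C$ the block matrix whose $(i,j)$ block is $A_{ij}C$), and $\{X,Y\}=XY+YX$ is the anticommutator. *)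

(* Defs.v *)
From mathcomp Require Export all_boot all_order all_algebra.
From mathcomp Require Export mxtens.

Set Implicit Arguments.
Unset Strict Implicit.
Unset Printing Implicit Defensive.
Import GRing.Theory Num.Theory.
Local Open Scope ring_scope.

(* The difference p - beta + 1 is taken in R, not in nat, so that it equals 0
   at beta = p + 1. *)
Definition green_coef (R : rcfType) (p beta : nat) : R :=
  Num.sqrt (beta%:R * (p%:R - beta%:R + 1)).

(* Ordinals start at 0: the indices alpha, beta in {1, ..., p+1} are i.+1 and
   j.+1. *)
Definition green (R : rcfType) (p : nat) : 'M[R]_(p.+1) :=
  \matrix_(i, j) (green_coef R p j.+1 * (i.+1 == j.+1 + 1)%N%:R).

Definition anticomm (R : pzRingType) (m : nat) (X Y : 'M[R]_m) : 'M[R]_m :=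
  X *m Y + Y *m X.

(* The Kronecker product A *t B of a 'M_m and a 'M_k is a 'M_(m * k); the
   following equations are only used to transport Green's matrices to the sizes
   2 ^ n and 2 ^ n * 2. *)
Lemma green_dim (n : nat) : (2 ^ n - 1).+1%N = (2 ^ n)%N.
Proof. by rewrite subn1 prednK // expn_gt0. Qed.

Lemma green_dim2 (n : nat) : (2 * (2 ^ n - 1) + 1).+1%N = (2 ^ n * 2)%N.
Proof. by rewrite addn1 -[RHS]mulnC -[in RHS]green_dim mulnS. Qed.

(* Main.v *)
Require Import Defs.
From mathcomp Require Import zify ring.
Import GRing.Theory Num.Theory.
Local Open Scope ring_scope.

(** A matrix [G] of size [m * 2] is an [m * m] array of 2 x 2 blocks.  Green's
    matrix of order 1 is the matrix unit with its 1 in row 1 and column 0, so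
    taking the anticommutator with [1%:M *t green R 1] acts inside each block, by
      [[a, b], [c, d]]  |->  [[b, 0], [a + d, b]]
    ([anticomm_tens_delta]).  In the Green matrix of order [2 * p + 1] the only
    nonzero entries sit just below the diagonal, so row and column indices have
    opposite parity there; since the position inside a block is the parity of
    the index, [a = d = 0], and the anticommutator is the array of the entries
    [b] tensored with the identity.  These [b] come from the coefficients of
    even index, and [green_coef_double] evaluates them as twice the entries of
    the Green matrix of order [p]; the factor 2 cancels the one half. *)

(** The radicand [2k * (2p + 1 - 2k + 1)] is four times [k * (p - k + 1)]. *)
Lemma green_coef_double (R : rcfType) (p k : nat) :
  green_coef R (2 * p + 1) (2 * k) = 2 * green_coef R p k.
Proof.
rewrite /green_coef !natrM natrD natrM.
have -> : 2 * k%:R * (2 * p%:R + 1 - 2 * k%:R + 1)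
          = 2 ^+ 2 * (k%:R * (p%:R - k%:R + 1)) :> R by ring.
by rewrite sqrtrM ?exprn_ge0 ?ler0n // sqrtr_sqr ger0_norm ?ler0n.
Qed.

Lemma green1_delta (R : rcfType) : green R 1 = delta_mx ord_max ord0.
Proof.
apply/matrixP => i j; rewrite !mxE /green_coef -!val_eqE /=.
case: i => [[|[|//]] ?]; case: j => [[|[|//]] ?] //=; rewrite ?mulr0 //.
by rewrite subrr add0r !mulr1 sqrtr1.
Qed.

Lemma ntens1mx (R : pzRingType) (m n : nat) :
  (1%:M : 'M[R]_m) ^t n = 1%:M.
Proof.
have tens11 a b : (1%:M : 'M[R]_a) *t (1%:M : 'M[R]_b) = 1%:M.
  apply/matrixP => i j; case: (mxtens_indexP i) => i0 i1.
  case: (mxtens_indexP j) => j0 j1; rewrite tensmxE !mxE -natrM mulnb.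
  by rewrite (can_eq (@mxtens_indexK _ _)) xpair_eqE.
by case: n => // n; elim: n => [|n IHn] //; rewrite ntensmxSS IHn tens11.
Qed.

Lemma mulmx_tens1_delta (R : pzRingType) (m k : nat) (a b s t : 'I_k)
    (c d : 'I_m) (G : 'M[R]_(m * k)) :
  (G *m ((1%:M : 'M[R]_m) *t delta_mx a b))
    (mxtens_index (c, s)) (mxtens_index (d, t))
  = G (mxtens_index (c, s)) (mxtens_index (d, a)) * (t == b)%:R.
Proof.
rewrite mxE (bigD1 (mxtens_index (d, a))) //= tensmxE !mxE !eqxx mul1r.
rewrite big1 ?addr0 // => j; case: (mxtens_indexP j) => j0 j1.
rewrite (can_eq (@mxtens_indexK _ _)) xpair_eqE tensmxE !mxE.
by case: (j0 == d); case: (j1 == a) => //= _; rewrite ?mul0r ?mulr0.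
Qed.

Lemma tens1_delta_mulmx (R : pzRingType) (m k : nat) (a b s t : 'I_k)
    (c d : 'I_m) (G : 'M[R]_(m * k)) :
  (((1%:M : 'M[R]_m) *t delta_mx a b) *m G)
    (mxtens_index (c, s)) (mxtens_index (d, t))
  = (s == a)%:R * G (mxtens_index (c, b)) (mxtens_index (d, t)).
Proof.
rewrite mxE (bigD1 (mxtens_index (c, b))) //= tensmxE !mxE !eqxx mul1r andbT.
rewrite big1 ?addr0 // => j; case: (mxtens_indexP j) => j0 j1.
rewrite (can_eq (@mxtens_indexK _ _)) xpair_eqE tensmxE !mxE (eq_sym c).
by case: (j0 == c); case: (j1 == b); rewrite //= ?andbF ?mulr0 ?mul0r.
Qed.

(** Multiplying on the right by the tensored matrix unit moves column 1 of each
    block into column 0 and clears column 1; multiplying on the left moves row 0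
    into row 1 and clears row 0.  Entry (0, 1) of a block thus reaches both
    diagonal places, and its two diagonal entries meet in place (1, 0). *)
Lemma anticomm_tens_delta (R : pzRingType) (m : nat) (c d : 'I_m) (s t : 'I_2)
    (G : 'M[R]_(m * 2)) :
  anticomm G ((1%:M : 'M[R]_m) *t delta_mx ord_max ord0)
    (mxtens_index (c, s)) (mxtens_index (d, t))
  = (if s == t then G (mxtens_index (c, ord0)) (mxtens_index (d, ord_max))
     else if s == ord0 then 0
     else G (mxtens_index (c, ord0)) (mxtens_index (d, ord0))
          + G (mxtens_index (c, ord_max)) (mxtens_index (d, ord_max))).
Proof.
rewrite mxE mulmx_tens1_delta tens1_delta_mulmx.
have ordP (i : 'I_2) : i = ord0 \/ i = ord_max.
  by case: i => [[|[|//]] ?]; [left | right]; apply: val_inj.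
case: (ordP s) => ->; case: (ordP t) => -> /=.
- by rewrite mulr1 mul0r addr0.
- by rewrite mulr0 mul0r addr0.
- by rewrite mulr1 mul1r addrC.
- by rewrite mulr0 mul1r add0r.
Qed.

Lemma green_castE (R : rcfType) (p q : nat) (e : p.+1 = q) (i j : 'I_q) :
  castmx (e, e) (green R p) i j
  = green_coef R p j.+1 * (i.+1 == j.+1 + 1)%N%:R.
Proof. by rewrite castmxE mxE. Qed.

Theorem mainTheorem1 (R : rcfType) (n : nat) (hn : (1 <= n)%N) :
  let p := (2 ^ n - 1)%N in
  let p' := (2 * p + 1)%N in
  2^-1 *: anticomm (castmx (green_dim2 n, green_dim2 n) (green R p'))
                   ((1%:M : 'M[R]_2) ^t n *t green R 1)
  = castmx (green_dim n, green_dim n) (green R p) *t (1%:M : 'M[R]_2).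
Proof.
move=> p p'; rewrite green1_delta ntens1mx; apply/matrixP => i j.
case: (mxtens_indexP i) => c s; case: (mxtens_indexP j) => d t.
rewrite tensmxE mxE anticomm_tens_delta !green_castE [1%:M _ _]mxE /=.
case: eqP => [_|_].
  (* The 1-based index of the column (d, 1) is 2 * (d + 1). *)
  have -> : (d * 2 + 1).+1 = (2 * d.+1)%N by lia.
  have -> : ((c * 2 + 0).+1 == 2 * d.+1 + 1)%N = (c.+1 == d.+1 + 1)%N by lia.
  by rewrite green_coef_double mulr1 -mulrA mulKf ?pnatr_eq0.
case: ifP => _; first by rewrite !mulr0.
(* The entries (0, 0) and (1, 1) of a block vanish by parity. *)
have -> : ((c * 2 + 0).+1 == (d * 2 + 0).+1 + 1)%N = false by lia.
have -> : ((c * 2 + 1).+1 == (d * 2 + 1).+1 + 1)%N = false by lia.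
by rewrite !mulr0 addr0 mulr0.
Qed.
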